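(* Let $f:[0,1]\to\mathbb{R}$ be continuously differentiable with $f(0)=f(1)$. Then for any continuous functions $\varphi,\psi:\mathbb{R}\to\mathbb{R}$, $$\big\langle\, (\varphi\circ f)\cdot f'\cdot [\![\,(\psi\circ f)\cdot f'\,]\!]\,\big\rangle=0 .$$
   Context: For a continuous function $g:[0,1]\to\mathbb{R}$ define its average $\langle g\rangle:=\int_0^1 g(y)\,dy$, its fluctuating part $\{g\}(y):=g(y)-\langle g\rangle$, and the function $$[\![g]\!](y):=\int_0^y\{g\}(\xi)\,d\xi-\int_0^1\int_0^\tau\{g\}(\xi)\,d\xi\,d\tau .$$ *)

(* Defs.v *)
From Stdlib Require Import Reals.
From Coquelicot Require Import Coquelicot.
Open Scope R_scope.

(* A function on [0,1] is encoded as a total function R -> R; the notions below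
   (with D := unit_itv) depend only on its values on [0,1]. *)
Definition unit_itv (x : R) : Prop := 0 <= x <= 1.

(* f is continuously differentiable on D with derivative f'.  The first clause
   is Coquelicot's is_derive with the neighbourhood filter relativized to D, so
   it is the one-sided derivative at an endpoint of an interval. *)
Definition C1_on (D : R -> Prop) (f f' : R -> R) : Prop :=
  (forall x, D x ->
     filterdiff f (within D (locally x)) (fun h => scal h (f' x))) /\
  continuous_on D f'.

Definition average (g : R -> R) : R := RInt g 0 1.

Definition fluct (g : R -> R) (y : R) : R := g y - average g.

Definition dbracket (g : R -> R) (y : R) : R :=
  RInt (fluct g) 0 y - RInt (fun tau => RInt (fluct g) 0 tau) 0 1.

(* Main.v *)
(** The average of [(psi o f) f'] is [0] because [f 0 = f 1], so its bracket is
    [Psi o f - c] on [0,1], with [Psi] a primitive of [psi] and [c] a constant.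
    The integrand is then [(theta o f) f'] with [theta = phi * (Psi - c)]
    continuous, and its average vanishes for the same reason. *)
Require Import Defs.
From Stdlib Require Import Reals Lra ssreflect.
From Coquelicot Require Import Coquelicot.
Open Scope R_scope.

(** The retraction of the line onto [0,1]. Composing with it turns a function continuous on [0,1]
    into one continuous everywhere, without changing its values on [0,1]. *)
Definition clamp (x : R) : R := Rmax 0 (Rmin 1 x).

Lemma clamp_unit (x : R) : unit_itv (clamp x).
Proof. unfold unit_itv, clamp, Rmax, Rmin; repeat destruct Rle_dec; lra. Qed.

Lemma clamp_id (x : R) : unit_itv x -> clamp x = x.
Proof. unfold unit_itv, clamp, Rmax, Rmin; repeat destruct Rle_dec; lra. Qed.

Lemma clamp_lipschitz (x y : R) : Rabs (clamp y - clamp x) <= Rabs (y - x).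
Proof.
unfold clamp, Rmax, Rmin, Rabs.
repeat destruct Rle_dec; repeat destruct Rcase_abs; lra.
Qed.

(** Being 1-Lipschitz with values in [0,1], [clamp] sends the neighbourhoods of [x] into the filter
    at [clamp x] relativized to [0,1]. *)
Lemma continuous_on_clamp (g : R -> R) (x : R) :
  continuous_on unit_itv g -> continuous (fun t => g (clamp t)) x.
Proof.
intros Hg.
apply (filterlim_comp _ _ _ clamp g _
         (within unit_itv (locally (clamp x))) _).
2: { apply Hg, clamp_unit. }
intros P [eps He]; exists eps; intros y Hy.
apply He; [|apply clamp_unit].
apply Rle_lt_trans with (2 := Hy), clamp_lipschitz.
Qed.

Lemma C1_on_continuous (D : R -> Prop) (f f' : R -> R) :
  C1_on D f f' -> continuous_on D f.
Proof.
intros [Hd _] x Dx.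
apply (filterdiff_continuous_aux (K := R_AbsRing) (U := R_NormedModule)
         (V := R_NormedModule) f).
- exists (fun h => scal h (f' x)); apply Hd, Dx.
- intros P HP; apply filter_le_within, HP.
Qed.

(** When [D] is itself a neighbourhood of [x], relativizing the filter to [D] changes nothing. *)
Lemma C1_on_is_derive (D : R -> Prop) (f f' : R -> R) (x : R) :
  C1_on D f f' -> locally x D -> is_derive f x (f' x).
Proof.
intros [Hd _] HD.
destruct (Hd x (locally_singleton _ _ HD)) as [Hl Hdom].
split; [exact Hl|].
intros z Hz eps.
assert (Hz' : is_filter_lim (within D (locally x)) z).
{ intros P HP; apply filter_le_within, Hz, HP. }
generalize (filter_and _ _ HD (Hdom z Hz' eps)).
apply filter_imp; intros y [Dy Hy]; exact (Hy Dy).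
Qed.

Lemma ex_RInt_cont (h : R -> R) (a b : R) :
  (forall x, continuous h x) -> ex_RInt h a b.
Proof. intros Hh; apply: ex_RInt_continuous; intros; apply Hh. Qed.

Lemma is_derive_primitive (h : R -> R) (a x : R) :
  (forall x, continuous h x) -> is_derive (fun u => RInt h a u) x (h x).
Proof.
intros Hh; apply (is_derive_RInt h _ a x); [|apply Hh].
apply filter_forall; intros u; apply: RInt_correct.
apply ex_RInt_cont, Hh.
Qed.

(* Coquelicot's substitution rule needs two-sided derivatives at the endpoints;
   the mean value theorem for the clamped functions only needs them inside. *)
Lemma C1_on_RInt_subst (f f' h : R -> R) (y : R) :
  C1_on unit_itv f f' -> (forall x, continuous h x) -> unit_itv y ->
  RInt (fun z => h (f z) * f' z) 0 y = RInt h (f 0) (f y).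
Proof.
intros HC Hh Hy.
set (fc := fun t => f (clamp t)).
set (k := fun t => h (fc t) * f' (clamp t)).
assert (Hfc : forall x, continuous fc x).
{ intros x; apply continuous_on_clamp, (C1_on_continuous _ _ _ HC). }
assert (Hk : forall x, continuous k x).
{ intros x; apply: continuous_mult.
  - apply continuous_comp; [apply Hfc | apply Hh].
  - apply continuous_on_clamp, HC. }
(* [F] is the difference of the two sides at [t], with clamped functions. Its derivative vanishes
   inside the interval by the chain rule, so [F y = F 0]. *)
set (F := fun t => RInt k 0 t - RInt h (f 0) (fc t)).
assert (HF : F y - F 0 = 0 * (y - 0)).
{ assert (H0 : forall x, Rmin 0 y < x < Rmax 0 y -> is_derive F x 0).
  { intros x Hx.
    rewrite -> Rmin_left in Hx by apply Hy; rewrite -> Rmax_right in Hx by apply Hy.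
    assert (Hx1 : 0 < x < 1) by (destruct Hy; lra).
    assert (HD : locally x unit_itv).
    { apply (locally_interval _ x 0 1); simpl; try lra.
      intros z Hz1 Hz2; split; simpl in *; lra. }
    (* Near an interior point [fc] coincides with [f], so it inherits the two-sided derivative. *)
    assert (Hdf : is_derive fc x (f' (clamp x))).
    { rewrite -> clamp_id by (unfold unit_itv; lra).
      apply (is_derive_ext_loc f); [|apply (C1_on_is_derive _ _ _ _ HC HD)].
      revert HD; apply filter_imp; intros z Hz; unfold fc.
      now rewrite clamp_id. }
    replace 0 with (minus (k x) (scal (f' (clamp x)) (h (fc x))))
      by (unfold k, minus, plus, opp, scal; simpl; unfold mult; simpl; ring).
    apply: is_derive_minus.
    - apply is_derive_primitive, Hk.
    - apply: (is_derive_comp (fun u => RInt h (f 0) u) fc); [|exact Hdf].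
      apply is_derive_primitive, Hh. }
  destruct (MVT_gen F 0 y (fun _ => 0) H0) as [c [_ Hc]]; [|exact Hc].
  intros x _; apply continuity_pt_filterlim.
  apply: continuous_minus.
  - apply: ex_derive_continuous; eexists; apply is_derive_primitive, Hk.
  - apply (continuous_comp fc (fun u => RInt h (f 0) u)); [apply Hfc|].
    apply: ex_derive_continuous; eexists; apply is_derive_primitive, Hh. }
(* At 0 both integrals run over a single point, hence [F 0 = 0] and the two sides agree at [y]. *)
assert (H0 : fc 0 = f 0) by (unfold fc; rewrite clamp_id; unfold unit_itv; lra).
assert (H1 : fc y = f y) by (unfold fc; now rewrite clamp_id).
unfold F in HF; rewrite -> H0, H1, !RInt_point in HF.
unfold zero in HF; simpl in HF.
transitivity (RInt k 0 y); [|lra].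
apply RInt_ext; intros x Hx.
rewrite -> Rmin_left in Hx by apply Hy; rewrite -> Rmax_right in Hx by apply Hy.
unfold k, fc; rewrite clamp_id; [reflexivity|].
destruct Hy; unfold unit_itv; lra.
Qed.

(** Substitution turns the average into an integral from [f 0] to [f 1], which are the same
    point. *)
Lemma average_subst_per (f f' h : R -> R) :
  C1_on unit_itv f f' -> f 0 = f 1 -> (forall x, continuous h x) ->
  average (fun z => h (f z) * f' z) = 0.
Proof.
intros HC Hp Hh; unfold average.
rewrite -> (C1_on_RInt_subst f f' h 1 HC Hh) by (unfold unit_itv; lra).
rewrite <- Hp; apply: RInt_point.
Qed.

Theorem proposition2 (f f' : R -> R)
  (f_C1 : C1_on unit_itv f f') (f_per : f 0 = f 1)
  (phi psi : R -> R)
  (phi_cont : forall x : R, continuous phi x)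
  (psi_cont : forall x : R, continuous psi x) :
  average (fun y =>
    phi (f y) * f' y * dbracket (fun z => psi (f z) * f' z) y) = 0.
Proof.
set (g := fun z => psi (f z) * f' z).
set (c := RInt (fun tau => RInt (fluct g) 0 tau) 0 1).
set (theta := fun u => phi u * (RInt psi (f 0) u - c)).
assert (Hg : forall y, unit_itv y ->
  dbracket g y = RInt psi (f 0) (f y) - c).
{ intros y Hy; unfold dbracket; fold c; f_equal.
  rewrite <- (C1_on_RInt_subst f f' psi y f_C1 psi_cont Hy).
  apply RInt_ext; intros x _; unfold fluct, g.
  (* Since [g] has average 0, it equals its own fluctuating part. *)
  rewrite (average_subst_per f f' psi f_C1 f_per psi_cont).
  apply Rminus_0_r. }
transitivity (average (fun z => theta (f z) * f' z)).
- apply RInt_ext; intros y Hy.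
  rewrite -> Rmin_left in Hy by lra; rewrite -> Rmax_right in Hy by lra.
  rewrite -> Hg by (unfold unit_itv; lra).
  unfold theta; simpl; ring.
- apply average_subst_per; try assumption.
  (* [theta] is continuous because the primitive of [psi] is differentiable. *)
  intros u; apply: continuous_mult; [apply phi_cont|].
  apply: continuous_minus; [|apply continuous_const].
  apply: ex_derive_continuous; eexists; apply is_derive_primitive, psi_cont.
Qed.
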